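(* For any $a,b,c\in\mathbb{N}_0$, $$t^{\star}(\{2\}^{a},3,\{2\}^{b},1,\{2\}^{c})=-\frac{4}{\pi}t(\overline{2a+2b+2c+5})-\frac{8}{\pi}t(\overline{2a+2},2b+2c+3)-\frac{8}{\pi}t(2a+2b+4,\overline{2c+1})-\frac{16}{\pi}t(\overline{2a+2},\overline{2b+2},\overline{2c+1})$$ and $$t^{\star}(\{2\}^{a},3,\{2\}^{b},3,\{2\}^{c})=-\frac{4}{\pi}t(\overline{2a+2b+2c+7})-\frac{8}{\pi}t(\overline{2a+2},2b+2c+5)-\frac{8}{\pi}t(\overline{2a+2b+5},2c+2)-\frac{16}{\pi}t(\overline{2a+2},2b+3,2c+2).$$
   Context: $t^{\star}(\boldsymbol{s})=\sum_{k_1\geq\cdots\geq k_r\geq1}\prod_{j}(2k_j-1)^{-s_j}$ for an index with $s_1>1$; $\{2\}^a$ is $2$ repeated $a$ times. Alternating multiple $t$-values: $t(\boldsymbol{s};\boldsymbol{\sigma})=\sum_{k_1>\cdots>k_r\geq1}\prod_{j}\frac{\sigma_j^{k_j}}{(2k_j-1)^{s_j}}$, where a bar over $s_j$ means $\sigma_j=-1$ and no bar means $\sigma_j=1$. *)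

(* Defs.v *)
From Stdlib Require Import Reals List.
From Coquelicot Require Import Coquelicot.
Import ListNotations.
Open Scope R_scope.

Fixpoint sumk (f : nat -> R) (N : nat) : R :=
  match N with
  | O => 0
  | S n => sumk f n + f (S n)
  end.

Fixpoint tstar_part (s : list nat) (N : nat) : R :=
  match s with
  | [] => 1
  | e :: r => sumk (fun k => / (INR (2 * k - 1)) ^ e * tstar_part r k) N
  end.

(* Truncated alternating multiple t-value: an index entry is (s_j, barred_j);
   barred means sigma_j = -1.  Sum over N >= k_1 > k_2 > ... > k_r >= 1 of
   prod_j sigma_j^(k_j) / (2k_j-1)^(s_j). *)
Fixpoint t_part (s : list (nat * bool)) (N : nat) : R :=
  match s with
  | [] => 1
  | (e, bar) :: r =>
      sumk (fun k => (if bar then (-1) ^ k else 1) / (INR (2 * k - 1)) ^ e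
                     * t_part r (k - 1)%nat) N
  end.

(* The (convergent, s_1 > 1) series values as limits of the truncations. *)
Definition tstar (s : list nat) : R := real (Lim_seq (tstar_part s)).
Definition tval (s : list (nat * bool)) : R := real (Lim_seq (t_part s)).

Definition nb (e : nat) : nat * bool := (e, false).
Definition br (e : nat) : nat * bool := (e, true).

(* Main.v *)
Require Import Defs.
From Stdlib Require Import Reals List Lra Lia.
From Coquelicot Require Import Coquelicot.
Import ListNotations.
Open Scope R_scope.

(** Write [x_k = 2k - 1]. Expanding [prod_(j <= n) 1 / (1 - x^2/x_j^2)] in partial
    fractions suggests the transform [T f n = sum_(k <= n) A_(n,k) f(k)], where
    [A_(n,k)] is the coefficient of [1 / (1 - x^2/x_k^2)]. Then [T 1 = 1], and
    prepending a [2] to a truncated star value [T f] replaces [f] by [f / x^2].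
    Moreover division of [T f] by [x_n] is again a transform:
    [T f n / x_n = T (x S (f / x^2)) n] with [S g k = g k + 2 sum_(j < k) g j].
    Hence prepending a [3] replaces [f] by [S (f / x^2) / x], and prepending a [1]
    replaces [f] by [S^-1 (f / x)], where [S^-1] is the same sum with alternating
    signs. So the truncated star values are transforms of explicit nested sums, and
    [n -> oo] gives the theorem because [A_(n,k) -> - (4 / PI) (-1)^k / x_k]; the
    constant comes from [T 1 = 1] and the Leibniz series. *)

(** * Finite sums and odd numbers *)

Lemma sumk_S (f : nat -> R) (n : nat) : sumk f (S n) = sumk f n + f (S n).
Proof. reflexivity. Qed.

Lemma sumk_ext (f g : nat -> R) (n : nat) :
  (forall k, (1 <= k <= n)%nat -> f k = g k) -> sumk f n = sumk g n.
Proof.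
  induction n as [|n IH]; simpl; intros H; [reflexivity|].
  rewrite IH, H; [reflexivity|lia|intros k Hk; apply H; lia].
Qed.

Lemma sumk_plus (f g : nat -> R) (n : nat) :
  sumk (fun k => f k + g k) n = sumk f n + sumk g n.
Proof. induction n as [|n IH]; simpl; [ring|rewrite IH; ring]. Qed.

Lemma sumk_scal (c : R) (f : nat -> R) (n : nat) :
  sumk (fun k => c * f k) n = c * sumk f n.
Proof. induction n as [|n IH]; simpl; [ring|rewrite IH; ring]. Qed.

Lemma sumk_sum_f_R0 (f : nat -> R) (n : nat) :
  sumk f (S n) = sum_f_R0 (fun k => f (S k)) n.
Proof.
  induction n as [|n IH]; [simpl; ring|].
  now rewrite sumk_S, IH.
Qed.

Lemma sqr_pow_m1 (k : nat) : (-1) ^ k * (-1) ^ k = 1.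
Proof. rewrite <- pow_add; replace (k + k)%nat with (2 * k)%nat by lia; apply pow_1_even. Qed.

(** At [k = 0] this is [-1], whereas [INR (2 * k - 1)] is [0] by truncated subtraction. Being never
    zero, it lets [field] work without a range for [k]. *)
Definition odd_real (k : nat) : R := 2 * INR k - 1.

Lemma odd_real_S (k : nat) : odd_real (S k) = odd_real k + 2.
Proof. unfold odd_real; rewrite S_INR; ring. Qed.

Lemma odd_real_pos (k : nat) : (1 <= k)%nat -> 0 < odd_real k.
Proof. intros H; apply le_INR in H; unfold odd_real; simpl in H; lra. Qed.

Lemma odd_real_neq0 (k : nat) : odd_real k <> 0.
Proof.
  destruct k as [|k]; [unfold odd_real; simpl; lra|].
  apply Rgt_not_eq, odd_real_pos; lia.
Qed.

Lemma INR_odd (k : nat) : (1 <= k)%nat -> INR (2 * k - 1) = odd_real k.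
Proof. intros H; rewrite minus_INR by lia; rewrite mult_INR; reflexivity. Qed.

(** * Partial fraction coefficients *)

(* [kernel n k = (n-1)! n! / ((n-k)! (n+k-1)!)] for [1 <= k <= n], and [0] for [k > n]. *)
Fixpoint kernel (n k : nat) : R :=
  match k with
  | O => 1
  | S j => kernel n j * ((INR n - INR j) / (INR n + INR j))
  end.

(** For [n >= 1] this is [((2n-1)!!)^2 / (4^(n-1) (n-1)! n!)]. The step to [n = 1] is separate
    because the general ratio would divide by [INR 0]. *)
Fixpoint wallis (n : nat) : R :=
  match n with
  | O => 1
  | S m => match m with
           | O => 1
           | S _ => wallis m * (odd_real (S m) ^ 2 / (4 * INR m * INR (S m)))
           end
  end.

(* [wallis n * - (-1)^k * kernel n k / odd_real k] is the coefficient of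
   [1 / (1 - x^2/(2k-1)^2)] in the partial fraction expansion of
   [prod_(j <= n) 1 / (1 - x^2/(2j-1)^2)]. *)
Definition transform (f : nat -> R) (n : nat) : R :=
  wallis n * sumk (fun k => - (-1) ^ k * kernel n k / odd_real k * f k) n.

Lemma kernel_S (n k : nat) :
  kernel n (S k) = kernel n k * ((INR n - INR k) / (INR n + INR k)).
Proof. reflexivity. Qed.

Lemma kernel_out (n k : nat) : (n < k)%nat -> kernel n k = 0.
Proof.
  induction k as [|k IH]; intros H; [lia|]; simpl.
  destruct (Nat.eq_dec n k) as [->|Hk].
  - unfold Rdiv; ring.
  - rewrite IH by lia; ring.
Qed.

Lemma kernel_ge0 (n k : nat) : 0 <= kernel n k.
Proof.
  induction k as [|k IH]; [simpl; lra|].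
  destruct (Nat.lt_ge_cases n (S k)) as [H|H]; [rewrite kernel_out by lia; lra|].
  simpl; apply Rmult_le_pos; [assumption|].
  apply le_INR in H; rewrite S_INR in H; pose proof (pos_INR k).
  apply Rmult_le_pos; [lra|left; apply Rinv_0_lt_compat; lra].
Qed.

Lemma kernel_decr (n k : nat) : (1 <= n)%nat -> kernel n (S k) <= kernel n k.
Proof.
  intros Hn; simpl; rewrite <- (Rmult_1_r (kernel n k)) at 2.
  apply Rmult_le_compat_l; [apply kernel_ge0|].
  apply lt_0_INR in Hn; pose proof (pos_INR k).
  apply Rle_div_l; lra.
Qed.

Lemma kernel_lim (k : nat) : is_lim_seq (fun n => kernel n k) 1.
Proof.
  induction k as [|k IH]; simpl; [apply is_lim_seq_const|].
  replace (Finite 1) with (Finite (1 * 1)) by (f_equal; ring).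
  apply is_lim_seq_mult'; [assumption|].
  apply is_lim_seq_ext_loc with (fun n => 1 - 2 * INR k * / (INR n + INR k)).
  - exists 1%nat; intros n Hn; apply lt_0_INR in Hn; pose proof (pos_INR k).
    field; lra.
  - replace (Finite 1) with (Finite (1 - 2 * INR k * 0)) by (f_equal; ring).
    apply is_lim_seq_minus'; [apply is_lim_seq_const|].
    apply is_lim_seq_mult'; [apply is_lim_seq_const|].
    change (Finite 0) with (Rbar_inv p_infty).
    apply is_lim_seq_inv; [|discriminate].
    eapply is_lim_seq_plus;
      [apply is_lim_seq_INR|apply is_lim_seq_const|reflexivity].
Qed.

Lemma wallis_S (n : nat) : (1 <= n)%nat ->
  wallis (S n) = wallis n * (odd_real (S n) ^ 2 / (4 * INR n * INR (S n))).
Proof. destruct n as [|n]; [lia|reflexivity]. Qed.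

(** A new factor [1 / (1 - x^2 / x_(n+1)^2)] in the product multiplies the coefficient at [x_k] by
    its value at [x = x_k]. With the denominator cleared, [k = n + 1] is covered too: both sides
    vanish there. *)
Lemma kernel_step (n k : nat) : (1 <= n)%nat ->
  wallis n * kernel n k
  = wallis (S n) * kernel (S n) k * (1 - (odd_real k / odd_real (S n)) ^ 2).
Proof.
  intros Hn.
  pose proof (odd_real_neq0 (S n)) as Ho; unfold odd_real in *.
  assert (Hn' := lt_0_INR _ Hn); rewrite S_INR in Ho.
  induction k as [|k IH].
  - rewrite wallis_S by assumption; simpl (kernel _ 0); unfold odd_real.
    rewrite S_INR; simpl (INR 0); field; lra.
  - pose proof (pos_INR k).
    rewrite !kernel_S, <- Rmult_assoc, IH.
    rewrite !S_INR; field; repeat split; lra.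
Qed.

(** * The transform: prepending a 2, and its value on the constant 1 *)

Lemma transform_ext (f g : nat -> R) (n : nat) :
  (forall k, (1 <= k)%nat -> f k = g k) -> transform f n = transform g n.
Proof.
  intros H; unfold transform; f_equal; apply sumk_ext; intros k Hk.
  now rewrite H by lia.
Qed.

(** By [kernel_step] the difference carries the termwise factor [1 - (1 - x_k^2 / x_(n+1)^2) = x_k^2
    / x_(n+1)^2]. *)
Lemma transform_step (f : nat -> R) (n : nat) : (1 <= n)%nat ->
  transform f (S n) - transform f n
  = / odd_real (S n) ^ 2 * transform (fun k => odd_real k ^ 2 * f k) (S n).
Proof.
  intros Hn; unfold transform.
  (* The added term is zero because [kernel n (n+1) = 0]; now both sums have the same range. *)
  replace (sumk (fun k => - (-1) ^ k * kernel n k / odd_real k * f k) n)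
    with (sumk (fun k => - (-1) ^ k * kernel n k / odd_real k * f k) (S n))
    by (rewrite sumk_S, (kernel_out n (S n)) by lia; unfold Rdiv; ring).
  rewrite <- !sumk_scal.
  rewrite (sumk_ext
    (fun k => wallis n * (- (-1) ^ k * kernel n k / odd_real k * f k))
    (fun k =>
       wallis (S n) * (- (-1) ^ k * kernel (S n) k / odd_real k * f k)
       + (-1) * (/ odd_real (S n) ^ 2 * (wallis (S n) *
         (- (-1) ^ k * kernel (S n) k / odd_real k * (odd_real k ^ 2 * f k)))))).
  - rewrite sumk_plus, !sumk_scal; ring.
  - intros k _.
    replace (wallis n * (- (-1) ^ k * kernel n k / odd_real k * f k))
      with (wallis n * kernel n k * (- (-1) ^ k / odd_real k * f k))
      by (unfold Rdiv; ring).
    rewrite kernel_step by assumption.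
    field; split; apply odd_real_neq0.
Qed.

(** By [transform_step] for [f / x^2], each summand is a difference of consecutive transforms, so
    the sum telescopes. The summand at [m = 1] is computed directly. *)
Lemma transform_cons2 (f : nat -> R) (n : nat) :
  sumk (fun m => / odd_real m ^ 2 * transform f m) n
  = transform (fun k => / odd_real k ^ 2 * f k) n.
Proof.
  induction n as [|n IH]; [unfold transform; simpl; ring|].
  rewrite sumk_S, IH; destruct n as [|n].
  - unfold transform, odd_real; simpl; field.
  - apply Rplus_eq_reg_l with (- transform (fun k => / odd_real k ^ 2 * f k) (S n)).
    rewrite <- Rplus_assoc, Rplus_opp_l, Rplus_0_l, Rplus_comm.
    change (?a + - ?b) with (a - b).
    rewrite transform_step by lia; f_equal.
    apply transform_ext; intros k _; field; apply odd_real_neq0.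
Qed.

(** A closed form for the partial sums whose factor [n - m] makes the full alternating sum, [m = n],
    vanish. *)
Lemma kernel_sum_odd (n m : nat) : (2 <= n)%nat -> (m <= n)%nat ->
  sumk (fun k => - (-1) ^ k * kernel n k * odd_real k) m
  = - (-1) ^ m * kernel n m * (INR m * (INR n - INR m) / (INR n - 1)).
Proof.
  intros Hn; assert (Hn' := le_INR _ _ Hn); simpl in Hn'.
  induction m as [|m IH]; intros Hm.
  - simpl; field; lra.
  - rewrite sumk_S, IH by lia; rewrite kernel_S; simpl pow.
    pose proof (pos_INR m); unfold odd_real; rewrite !S_INR; field; lra.
Qed.

(** This is the partial fraction identity at [x = 0]. By [transform_step] the increment in [n] is a
    multiple of the transform of [x^2], which is zero by [kernel_sum_odd]. *)
Lemma transform_1 (n : nat) : (1 <= n)%nat -> transform (fun _ => 1) n = 1.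
Proof.
  induction n as [|n IH]; [lia|]; intros _; destruct n as [|n].
  - unfold transform, odd_real; simpl; field.
  - assert (H := transform_step (fun _ => 1) (S n) ltac:(lia)).
    rewrite IH in H by lia.
    assert (H0 : transform (fun k => odd_real k ^ 2 * 1) (S (S n)) = 0).
    { unfold transform.
      rewrite (sumk_ext _
        (fun k => - (-1) ^ k * kernel (S (S n)) k * odd_real k)).
      - rewrite kernel_sum_odd by lia; unfold Rdiv; ring.
      - intros k _; field; apply odd_real_neq0. }
    rewrite H0 in H; lra.
Qed.

(** * Prepending a 3 or a 1 *)

Definition strict_sum (g : nat -> R) (k : nat) : R := g k + 2 * sumk g (k - 1).

Definition alt_strict_sum (g : nat -> R) (k : nat) : R :=
  g k + 2 * (-1) ^ k * sumk (fun j => (-1) ^ j * g j) (k - 1).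

(* As generating series in a shift [z], the two operators are multiplication by
   [(1+z)/(1-z)] and by [(1-z)/(1+z)]. *)
Lemma strict_sum_alt (g : nat -> R) (k : nat) : (1 <= k)%nat ->
  strict_sum (alt_strict_sum g) k = g k.
Proof.
  (* Summation multiplies the generating series by [1/(1-z)], which turns [(1-z)/(1+z)] into
     [1/(1+z)]. *)
  assert (H : forall n, sumk (alt_strict_sum g) n
                        = (-1) ^ n * sumk (fun j => (-1) ^ j * g j) n).
  { induction n as [|n IH]; [simpl; ring|].
    rewrite !sumk_S, IH; unfold alt_strict_sum; simpl; rewrite Nat.sub_0_r.
    replace ((-1 * (-1) ^ n) * (sumk (fun j => (-1) ^ j * g j) n
             + -1 * (-1) ^ n * g (S n)))
      with (- ((-1) ^ n * sumk (fun j => (-1) ^ j * g j) n)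
            + (-1) ^ n * (-1) ^ n * g (S n)) by ring.
    rewrite sqr_pow_m1; ring. }
  destruct k as [|k]; [lia|]; intros _.
  unfold strict_sum; rewrite H; unfold alt_strict_sum; simpl.
  rewrite Nat.sub_0_r; ring.
Qed.

(** Summation by parts. With [c_k = - (-1)^k * kernel n k], the weights [c_k (1 - x_k / x_n)] have
    increments [2 c_(k+1)], since [c_(k+1) / c_k = - (x_n - x_k) / (x_n + x_(k+1))] for [k <= n]. At
    [m = n] the boundary term vanishes. *)
Lemma kernel_strict_sum (h : nat -> R) (n m : nat) : (1 <= n)%nat ->
  sumk (fun k => - (-1) ^ k * kernel n k
                 * (strict_sum h k - odd_real k / odd_real n * h k)) m
  = - (-1) ^ m * kernel n m * (1 - odd_real m / odd_real n) * sumk h m.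
Proof.
  intros Hn; assert (Hn' := lt_0_INR _ Hn).
  pose proof (odd_real_neq0 n) as Ho.
  induction m as [|m IH]; [simpl; ring|].
  rewrite !sumk_S, IH; unfold strict_sum; simpl pow; rewrite kernel_S.
  replace (S m - 1)%nat with m by lia.
  pose proof (pos_INR m); unfold odd_real in *; rewrite !S_INR; field; lra.
Qed.

Lemma transform_strict_sum (f : nat -> R) (n : nat) : (1 <= n)%nat ->
  transform (fun k => odd_real k * strict_sum (fun j => / odd_real j ^ 2 * f j) k) n
  = / odd_real n * transform f n.
Proof.
  intros Hn; unfold transform.
  set (h := fun j => / odd_real j ^ 2 * f j).
  rewrite <- Rmult_assoc, (Rmult_comm (/ _)), Rmult_assoc; f_equal.
  rewrite <- sumk_scal.
  assert (H := kernel_strict_sum h n n Hn).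
  rewrite (sumk_ext _ (fun k =>
    - (-1) ^ k * kernel n k / odd_real k * (odd_real k * strict_sum h k)
    + (-1) * (/ odd_real n * (- (-1) ^ k * kernel n k / odd_real k * f k)))) in H.
  - rewrite sumk_plus, sumk_scal in H.
    replace (1 - odd_real n / odd_real n) with 0 in H by (field; apply odd_real_neq0).
    rewrite Rmult_0_r, Rmult_0_l in H; lra.
  - intros k _; unfold h; field; split; apply odd_real_neq0.
Qed.

Lemma transform_cons3 (f : nat -> R) (n : nat) :
  sumk (fun m => / odd_real m ^ 3 * transform f m) n
  = transform (fun k =>
      / odd_real k * strict_sum (fun j => / odd_real j ^ 2 * f j) k) n.
Proof.
  rewrite (sumk_ext _ (fun m => / odd_real m ^ 2 * transform (fun k =>
    odd_real k * strict_sum (fun j => / odd_real j ^ 2 * f j) k) m)).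
  - rewrite transform_cons2; apply transform_ext; intros k _.
    field; apply odd_real_neq0.
  - intros m Hm; rewrite transform_strict_sum by lia; field; apply odd_real_neq0.
Qed.

(** The division rule is read backwards: [g] satisfies [x * strict_sum g = f], so [transform f m] is
    [/ x_m] times the transform of [x^2 g]. The outer weight becomes [/ x_m^2], and
    [transform_cons2] applies. *)
Lemma transform_cons1 (f : nat -> R) (n : nat) :
  sumk (fun m => / odd_real m * transform f m) n
  = transform (alt_strict_sum (fun j => / odd_real j * f j)) n.
Proof.
  set (g := alt_strict_sum (fun j => / odd_real j * f j)).
  rewrite (sumk_ext _ (fun m => / odd_real m ^ 2
             * transform (fun k => odd_real k ^ 2 * g k) m)).
  - rewrite transform_cons2; apply transform_ext; intros k _.
    field; apply odd_real_neq0.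
  - intros m Hm.
    assert (H := transform_strict_sum (fun k => odd_real k ^ 2 * g k) m ltac:(lia)).
    rewrite (transform_ext _ f) in H.
    + rewrite H; field; apply odd_real_neq0.
    + intros k Hk.
      replace (strict_sum (fun j => / odd_real j ^ 2 * (odd_real j ^ 2 * g j)) k)
        with (strict_sum g k).
      * unfold g; rewrite strict_sum_alt by assumption; field; apply odd_real_neq0.
      * unfold strict_sum; f_equal; [field; apply odd_real_neq0|].
        f_equal; apply sumk_ext; intros j _; field; apply odd_real_neq0.
Qed.

(** * The limit of the transform *)

(* Abel summation turns the weights into the averages [kernel n k - kernel n (k+1) >= 0]
   of the partial sums, so conditional convergence is enough. *)
Lemma kernel_regular (u : nat -> R) (l : R) :
  is_lim_seq (sumk u) l ->
  is_lim_seq (fun n => sumk (fun k => kernel n k * u k) n) l.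
Proof.
  intros Hu.
  destruct (filterlim_bounded (sumk u) (ex_intro _ l Hu)) as [M0 HM0].
  set (M := M0 + Rabs l).
  assert (HM : forall m, Rabs (sumk u m - l) <= M).
  { intros m; eapply Rle_trans; [apply Rabs_triang|].
    rewrite Rabs_Ropp; apply Rplus_le_compat_r, HM0. }
  assert (M_ge0 : 0 <= M) by (eapply Rle_trans; [apply Rabs_pos|apply (HM 0%nat)]).
  (* Abel summation in incremental form. At [m = 0] the tracked quantity is zero, since
     [kernel n 0 = 1] and the empty sum is [0]. *)
  assert (Hstep : forall n m,
    sumk (fun k => kernel n k * u k) (S m) - l - kernel n (S m) * (sumk u (S m) - l)
    = sumk (fun k => kernel n k * u k) m - l - kernel n m * (sumk u m - l)
      + (kernel n m - kernel n (S m)) * (sumk u m - l)).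
  { intros n m; rewrite !sumk_S; ring. }
  assert (Habs : forall n m c, (1 <= n)%nat -> Rabs (sumk u m - l) <= c ->
    Rabs ((kernel n m - kernel n (S m)) * (sumk u m - l))
    <= (kernel n m - kernel n (S m)) * c).
  { intros n m c Hn Hc; pose proof (kernel_decr n m Hn).
    rewrite Rabs_mult, (Rabs_right (kernel n m - _)) by lra.
    apply Rmult_le_compat_l; lra. }
  assert (Hlow : forall n m, (1 <= n)%nat ->
    Rabs (sumk (fun k => kernel n k * u k) m - l - kernel n m * (sumk u m - l))
    <= M * (1 - kernel n m)).
  { intros n m Hn; induction m as [|m IH].
    - simpl; match goal with |- Rabs ?z <= _ => replace z with 0 by ring end.
      rewrite Rabs_R0; lra.
    - rewrite Hstep; eapply Rle_trans; [apply Rabs_triang|].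
      pose proof (Habs n m M Hn (HM m)); lra. }
  apply is_lim_seq_spec; intros [eps Heps]; simpl.
  apply is_lim_seq_spec in Hu.
  destruct (Hu (mkposreal (eps / 2) ltac:(lra))) as [K HK]; simpl in HK.
  (* Before [K] only the bound [M] is available, but the total weight there, [1 - kernel n K], tends
     to zero; from [K] on the deviations are below [eps / 2]. *)
  assert (Hhigh : forall n m, (1 <= n)%nat -> (K <= m)%nat ->
    Rabs (sumk (fun k => kernel n k * u k) m - l - kernel n m * (sumk u m - l))
    <= M * (1 - kernel n K) + eps / 2 * (kernel n K - kernel n m)).
  { intros n m Hn Hm; induction Hm as [|m Hm IH].
    - eapply Rle_trans; [apply Hlow; assumption|lra].
    - rewrite Hstep; eapply Rle_trans; [apply Rabs_triang|].
      pose proof (Habs n m (eps / 2) Hn (Rlt_le _ _ (HK m Hm))); lra. }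
  assert (HlimK := kernel_lim K); apply is_lim_seq_spec in HlimK.
  (* Dividing by [M + 1] keeps the threshold meaningful when [M = 0]. *)
  assert (Hd : 0 < eps / 2 / (M + 1)) by (apply Rdiv_lt_0_compat; lra).
  destruct (HlimK (mkposreal _ Hd)) as [N HN]; simpl in HN.
  exists (S (N + K)); intros n Hn.
  assert (Hn1 : (1 <= n)%nat) by lia.
  pose proof (Hhigh n n Hn1 ltac:(lia)) as H1.
  pose proof (HN n ltac:(lia)) as H2.
  pose proof (HK n ltac:(lia)) as H3.
  pose proof (kernel_ge0 n n) as H4.
  assert (H5 : kernel n K <= 1).
  { clear - Hn1; induction K as [|K IH]; [simpl; lra|].
    pose proof (kernel_decr n K Hn1); lra. }
  assert (H6 : M * (1 - kernel n K) < eps / 2).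
  { rewrite Rabs_left1 in H2 by lra.
    apply Rle_lt_trans with ((M + 1) * (1 - kernel n K)); [nra|].
    replace (eps / 2) with ((M + 1) * (eps / 2 / (M + 1))) by (field; lra).
    apply Rmult_lt_compat_l; lra. }
  assert (H7 : Rabs (kernel n n * (sumk u n - l)) <= kernel n n * (eps / 2)).
  { rewrite Rabs_mult, (Rabs_right (kernel n n)) by lra.
    apply Rmult_le_compat_l; lra. }
  replace (sumk (fun k => kernel n k * u k) n - l) with
    ((sumk (fun k => kernel n k * u k) n - l - kernel n n * (sumk u n - l))
     + kernel n n * (sumk u n - l)) by ring.
  eapply Rle_lt_trans; [apply Rabs_triang|].
  assert (H8 : kernel n K * (eps / 2) <= 1 * (eps / 2))
    by (apply Rmult_le_compat_r; lra).
  lra.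
Qed.

Lemma Leibniz_odd :
  is_lim_seq (sumk (fun k => - (-1) ^ k / odd_real k)) (PI / 4).
Proof.
  apply is_lim_seq_incr_1.
  apply is_lim_seq_ext with (sum_f_R0 (tg_alt PI_tg)).
  - intros n; rewrite sumk_sum_f_R0; apply sum_eq; intros k _.
    unfold tg_alt, PI_tg; rewrite plus_INR, mult_INR; unfold odd_real.
    rewrite (S_INR k); simpl; pose proof (pos_INR k); field; lra.
  - rewrite <- Alt_PI_eq; unfold Alt_PI; destruct exist_PI as [l Hl].
    replace (4 * l / 4) with l by field; now apply is_lim_seq_Reals.
Qed.

(** By [transform_1], [wallis n] is the reciprocal of the Leibniz sum weighted by [kernel n], and
    [kernel_regular] sends that sum to [PI / 4]. *)
Lemma wallis_lim : is_lim_seq wallis (4 / PI).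
Proof.
  assert (H := kernel_regular _ _ Leibniz_odd).
  apply is_lim_seq_inv in H; [|intros E; injection E; pose proof PI_RGT_0; lra].
  replace (4 / PI) with (/ (PI / 4)) by (field; apply PI_neq0).
  eapply is_lim_seq_ext_loc, H; exists 1%nat; intros n Hn.
  assert (H1 := transform_1 n Hn); unfold transform in H1.
  rewrite (sumk_ext _ (fun k => kernel n k * (- (-1) ^ k / odd_real k))) in H1
    by (intros k _; unfold Rdiv; ring).
  symmetry; apply Rmult_eq_reg_r with
    (sumk (fun k => kernel n k * (- (-1) ^ k / odd_real k)) n).
  - rewrite H1, Rinv_l; [reflexivity|].
    intros E; rewrite E, Rmult_0_r in H1; lra.
  - intros E; rewrite E, Rmult_0_r in H1; lra.
Qed.

Lemma transform_lim (f : nat -> R) (l : R) :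
  is_lim_seq (sumk (fun k => (-1) ^ k / odd_real k * f k)) l ->
  is_lim_seq (transform f) (- (4 / PI) * l).
Proof.
  intros H; unfold transform.
  replace (- (4 / PI) * l) with (4 / PI * (-1 * l)) by ring.
  apply is_lim_seq_mult'; [apply wallis_lim|].
  apply is_lim_seq_ext with
    (fun n => -1 * sumk (fun k => kernel n k * ((-1) ^ k / odd_real k * f k)) n).
  - intros n; rewrite <- sumk_scal; apply sumk_ext; intros k _; unfold Rdiv; ring.
  - apply is_lim_seq_mult'; [apply is_lim_seq_const|].
    now apply kernel_regular.
Qed.

(** The comparison starts at [n = 1] because [transform f 0 = 0], while the empty index has value
    [1] at every truncation. *)
Lemma tstar_transform (s : list nat) (f : nat -> R) (l : R) :
  (forall n, (1 <= n)%nat -> tstar_part s n = transform f n) ->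
  is_lim_seq (sumk (fun k => (-1) ^ k / odd_real k * f k)) l ->
  tstar s = - (4 / PI) * l.
Proof.
  intros Hs Hl; unfold tstar.
  rewrite (is_lim_seq_unique (tstar_part s) (- (4 / PI) * l)); [reflexivity|].
  apply is_lim_seq_ext_loc with (transform f); [|now apply transform_lim].
  exists 1%nat; intros n Hn; symmetry; now apply Hs.
Qed.

(** * Convergence of the alternating t-values *)

Definition bounded (v : nat -> R) : Prop := exists C, forall n, Rabs (v n) <= C.

Lemma bounded_lim (v : nat -> R) (l : R) : is_lim_seq v l -> bounded v.
Proof.
  intros H; destruct (filterlim_bounded v (ex_intro _ l H)) as [C HC].
  exists C; exact HC.
Qed.

Lemma t_part_S (e : nat) (s : bool) (r : list (nat * bool)) (n : nat) :
  t_part ((e, s) :: r) (S n) = t_part ((e, s) :: r) n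
    + (if s then (-1) ^ S n else 1) / odd_real (S n) ^ e * t_part r n.
Proof.
  rewrite <- INR_odd by lia.
  replace (t_part r n) with (t_part r (S n - 1)) by (f_equal; lia).
  reflexivity.
Qed.

Lemma t_part_lim (e : nat) (s : bool) (r : list (nat * bool)) :
  (2 <= e)%nat -> bounded (t_part r) ->
  is_lim_seq (t_part ((e, s) :: r)) (tval ((e, s) :: r)).
Proof.
  intros He [C HC].
  assert (H : ex_finite_lim_seq (t_part ((e, s) :: r))).
  2: { destruct H as [l Hl]; unfold tval; now rewrite (is_lim_seq_unique _ _ Hl). }
  set (a := fun n : nat => t_part ((e, s) :: r) (S n) - t_part ((e, s) :: r) n).
  (* A telescoping majorant: [(n+1)(n+2)/2 <= (2n+1)^2], with equality at [n = 0], hence the factor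
     [2]. *)
  set (d := fun n : nat => 2 * C * (/ INR (S n) - / INR (S (S n)))).
  assert (Hd : ex_series d).
  { exists (2 * C * (1 - 0)); change (is_lim_seq (sum_n d) (2 * C * (1 - 0))).
    apply is_lim_seq_ext with (fun n => 2 * C * (1 - / INR (S (S n)))).
    - intros n; induction n as [|n IH].
      + rewrite sum_O; unfold d; simpl; field.
      + rewrite sum_Sn, <- IH; unfold d; change plus with Rplus; ring.
    - apply is_lim_seq_mult'; [apply is_lim_seq_const|].
      apply is_lim_seq_minus'; [apply is_lim_seq_const|].
      apply (is_lim_seq_incr_1 (fun n => / INR (S n))).
      apply (is_lim_seq_incr_1 (fun n => / INR n)).
      apply is_lim_seq_inv with (l := p_infty); [apply is_lim_seq_INR|discriminate]. }
  assert (Ha : ex_series a).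
  { apply (ex_series_le a d); [|exact Hd].
    intros n; unfold a; rewrite t_part_S; change norm with Rabs.
    match goal with |- Rabs ?z <= _ =>
      replace z with ((if s then (-1) ^ S n else 1) * / odd_real (S n) ^ e * t_part r n)
        by (unfold Rdiv; ring) end.
    rewrite !Rabs_mult.
    assert (Hs : Rabs (if s then (-1) ^ S n else 1) = 1)
      by (destruct s; [apply pow_1_abs|apply Rabs_R1]).
    rewrite Hs, Rmult_1_l.
    pose proof (pos_INR n) as Hn.
    assert (Ho : 1 <= odd_real (S n)) by (unfold odd_real; rewrite S_INR; lra).
    assert (Hp : odd_real (S n) ^ 2 <= odd_real (S n) ^ e) by now apply Rle_pow.
    assert (0 < odd_real (S n) ^ 2) by (apply pow_lt; lra).
    rewrite Rabs_right by (left; apply Rinv_0_lt_compat; lra).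
    apply Rle_trans with (/ odd_real (S n) ^ 2 * C).
    - apply Rmult_le_compat; [left; apply Rinv_0_lt_compat; lra|apply Rabs_pos| |apply HC].
      apply Rinv_le_contravar; lra.
    - assert (0 <= C) by (eapply Rle_trans; [apply Rabs_pos|apply (HC 0%nat)]).
      unfold d; rewrite (Rmult_comm 2 C), Rmult_assoc, Rmult_comm.
      apply Rmult_le_compat_l; [assumption|].
      rewrite !S_INR.
      replace (2 * (/ (INR n + 1) - / (INR n + 1 + 1)))
        with (/ ((INR n + 1) * (INR n + 2) / 2)) by (field; lra).
      apply Rinv_le_contravar; [nra|].
      unfold odd_real; rewrite S_INR; nra. }
  destruct Ha as [l Hl]; exists (l + t_part ((e, s) :: r) 0).
  apply is_lim_seq_incr_1.
  apply is_lim_seq_ext with (fun n => sum_n a n + t_part ((e, s) :: r) 0).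
  - intros n; induction n as [|n IH].
    + rewrite sum_O; unfold a; ring.
    + rewrite sum_Sn; change plus with Rplus.
      rewrite (Rplus_comm (sum_n a n)), Rplus_assoc, IH; unfold a; ring.
  - apply is_lim_seq_plus'; [exact Hl|apply is_lim_seq_const].
Qed.

Lemma t_part_bounded (e : nat) (s : bool) (r : list (nat * bool)) :
  (2 <= e)%nat -> bounded (t_part r) -> bounded (t_part ((e, s) :: r)).
Proof. intros He Hr; eapply bounded_lim, t_part_lim; assumption. Qed.

Lemma t_part_nil_bounded : bounded (t_part []).
Proof. exists 1; intros n; simpl; rewrite Rabs_R1; lra. Qed.

(** Needed for the innermost [br (2*c+1)], whose exponent is [1] when [c = 0], so that absolute
    convergence fails. Alternation with decreasing terms keeps the partial sums in [[-1, 0]]. *)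
Lemma t_part_alt_bounded (e : nat) : bounded (t_part [br e]).
Proof.
  set (p := fun n => / odd_real (S n) ^ e).
  assert (Hp : forall n, 0 < p n).
  { intros n; apply Rinv_0_lt_compat, pow_lt, odd_real_pos; lia. }
  assert (Hdecr : forall n, p (S n) <= p n).
  { intros n; apply Rinv_le_contravar; [apply pow_lt, odd_real_pos; lia|].
    apply pow_incr; rewrite (odd_real_S (S n)).
    pose proof (odd_real_pos (S n) ltac:(lia)); lra. }
  (* The margins [p] leave room for the next term, which makes the bounds inductive. *)
  assert (H : forall n,
    (-1 <= t_part [br e] (S (2 * n)) <= - p (2 * n)%nat) /\
    (-1 + p (S (2 * n)) <= t_part [br e] (S (S (2 * n))) <= 0)).
  { assert (Hodd : forall n, t_part [br e] (S (2 * n)) = t_part [br e] (2 * n) - p (2 * n)%nat).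
    { intros n; unfold br; rewrite t_part_S, pow_1_odd; unfold p, Rdiv; simpl t_part at 2; ring. }
    assert (Heven : forall n, t_part [br e] (S (S (2 * n)))
                              = t_part [br e] (S (2 * n)) + p (S (2 * n))).
    { intros n; unfold br; rewrite t_part_S.
      assert (Hpow : (-1) ^ S (S (2 * n)) = 1)
        by (replace (S (S (2 * n))) with (2 * S n)%nat by lia; apply pow_1_even).
      rewrite Hpow; unfold p, Rdiv; simpl t_part at 2; ring. }
    intros n; induction n as [|n IH].
    - rewrite Heven, Hodd; simpl (2 * 0)%nat.
      pose proof (Hdecr 0%nat).
      assert (p 0%nat = 1)
        by (unfold p, odd_real; simpl; replace (2 * 1 - 1) with 1 by ring;
            rewrite pow1; field).
      simpl t_part; lra.
    - rewrite Heven, Hodd; replace (2 * S n)%nat with (S (S (2 * n))) by lia.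
      pose proof (Hdecr (S (2 * n))); pose proof (Hdecr (S (S (2 * n)))).
      lra. }
  exists 1; intros n; apply Rabs_le.
  destruct (Nat.Even_or_Odd n) as [[m Hm]|[m Hm]]; subst n.
  - destruct m as [|m]; [simpl; lra|].
    replace (2 * S m)%nat with (S (S (2 * m))) by lia.
    pose proof (H m); pose proof (Hp (S (2 * m))); lra.
  - rewrite Nat.add_1_r; pose proof (H m); pose proof (Hp (2 * m)%nat); lra.
Qed.

(** * Truncated star values as transforms *)

Lemma tstar_part_cons (e : nat) (s : list nat) (f : nat -> R) (n : nat) :
  (forall k, (1 <= k)%nat -> tstar_part s k = transform f k) ->
  tstar_part (e :: s) n = sumk (fun m => / odd_real m ^ e * transform f m) n.
Proof.
  intros H; simpl tstar_part; apply sumk_ext; intros k Hk.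
  rewrite H, <- INR_odd by lia; reflexivity.
Qed.

Lemma tstar_part_twos (a : nat) (s : list nat) (f : nat -> R) :
  (forall n, (1 <= n)%nat -> tstar_part s n = transform f n) ->
  forall n, (1 <= n)%nat ->
  tstar_part (repeat 2%nat a ++ s) n
  = transform (fun k => / odd_real k ^ (2 * a) * f k) n.
Proof.
  intros H; induction a as [|a IH]; intros n Hn.
  - simpl (repeat _ _ ++ s); rewrite H by assumption; apply transform_ext.
    intros k _; simpl; field.
  - change (repeat 2%nat (S a) ++ s) with (2%nat :: (repeat 2%nat a ++ s)).
    rewrite (tstar_part_cons _ _ _ _ IH), transform_cons2.
    apply transform_ext; intros k _.
    replace (2 * S a)%nat with (2 + 2 * a)%nat by lia; rewrite pow_add.
    field; split; [apply pow_nonzero|]; apply odd_real_neq0.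
Qed.

Lemma t_part_br_S (e : nat) (r : list (nat * bool)) (n : nat) :
  t_part (br e :: r) (S n) = t_part (br e :: r) n
    + (-1) ^ S n / odd_real (S n) ^ e * t_part r n.
Proof. apply t_part_S. Qed.

Lemma t_part_nb_S (e : nat) (r : list (nat * bool)) (n : nat) :
  t_part (nb e :: r) (S n) = t_part (nb e :: r) n
    + 1 / odd_real (S n) ^ e * t_part r n.
Proof. apply t_part_S. Qed.

Lemma tstar_part_repeat2 (c n : nat) : (1 <= n)%nat ->
  tstar_part (repeat 2%nat c) n = transform (fun k => / odd_real k ^ (2 * c) * 1) n.
Proof.
  rewrite <- (app_nil_r (repeat _ _)); apply tstar_part_twos.
  intros m Hm; now rewrite transform_1.
Qed.

Lemma tstar_part_31 (a b c n : nat) : (1 <= n)%nat ->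
  tstar_part (repeat 2%nat a ++ 3%nat :: repeat 2%nat b ++ 1%nat :: repeat 2%nat c) n
  = transform (fun k => / odd_real k ^ (2 * a) *
      (/ odd_real k * strict_sum (fun j => / odd_real j ^ 2 *
        (/ odd_real j ^ (2 * b) *
          alt_strict_sum (fun i => / odd_real i * (/ odd_real i ^ (2 * c) * 1)) j)) k)) n.
Proof.
  revert n; apply tstar_part_twos; intros n _; rewrite <- transform_cons3.
  apply tstar_part_cons; clear n; apply tstar_part_twos; intros n _.
  rewrite <- transform_cons1, (tstar_part_cons _ _ _ _ (tstar_part_repeat2 c)).
  apply sumk_ext; intros k _; now rewrite pow_1.
Qed.

Lemma tstar_part_33 (a b c n : nat) : (1 <= n)%nat ->
  tstar_part (repeat 2%nat a ++ 3%nat :: repeat 2%nat b ++ 3%nat :: repeat 2%nat c) n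
  = transform (fun k => / odd_real k ^ (2 * a) *
      (/ odd_real k * strict_sum (fun j => / odd_real j ^ 2 *
        (/ odd_real j ^ (2 * b) *
          (/ odd_real j * strict_sum (fun i =>
             / odd_real i ^ 2 * (/ odd_real i ^ (2 * c) * 1)) j))) k)) n.
Proof.
  revert n; apply tstar_part_twos; intros n _; rewrite <- transform_cons3.
  apply tstar_part_cons; clear n; apply tstar_part_twos; intros n _.
  rewrite <- transform_cons3; apply tstar_part_cons, tstar_part_repeat2.
Qed.

(** * Expansion of the nested sums into t-values *)

Ltac field_odd :=
  rewrite ?pow_add; field; repeat split;
  try apply pow_nonzero; apply odd_real_neq0.

(** Each of the two operators splits into a diagonal term, where adjacent entries merge and their
    exponents add, and twice a strict term; hence the coefficients 1, 2, 2, 4. Merging two barred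
    entries cancels the bars. *)
Lemma series_31 (a b c n : nat) :
  sumk (fun k => (-1) ^ k / odd_real k * (/ odd_real k ^ (2 * a) *
    (/ odd_real k * strict_sum (fun j => / odd_real j ^ 2 *
      (/ odd_real j ^ (2 * b) *
        alt_strict_sum (fun i => / odd_real i * (/ odd_real i ^ (2 * c) * 1)) j)) k))) n
  = t_part [br (2*a+2*b+2*c+5)] n
    + 2 * t_part [br (2*a+2); nb (2*b+2*c+3)] n
    + 2 * t_part [nb (2*a+2*b+4); br (2*c+1)] n
    + 4 * t_part [br (2*a+2); br (2*b+2); br (2*c+1)] n.
Proof.
  assert (H1 : forall m,
    sumk (fun i => (-1) ^ i * (/ odd_real i * (/ odd_real i ^ (2 * c) * 1))) m
    = t_part [br (2*c+1)] m).
  { induction m as [|m IH]; [reflexivity|].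
    rewrite sumk_S, t_part_br_S, IH; cbn [t_part]; field_odd. }
  assert (H2 : forall m,
    sumk (fun j => / odd_real j ^ 2 * (/ odd_real j ^ (2 * b) *
      alt_strict_sum (fun i => / odd_real i * (/ odd_real i ^ (2 * c) * 1)) j)) m
    = t_part [nb (2*b+2*c+3)] m + 2 * t_part [br (2*b+2); br (2*c+1)] m).
  { induction m as [|m IH]; [simpl; ring|].
    rewrite sumk_S, t_part_br_S, t_part_nb_S, IH; unfold alt_strict_sum.
    replace (S m - 1)%nat with m by lia; rewrite H1.
    generalize (t_part [br (2*c+1)] m); intros x; cbn [t_part]; field_odd. }
  induction n as [|n IH]; [simpl; ring|].
  rewrite sumk_S, !t_part_br_S, t_part_nb_S, IH; unfold strict_sum.
  replace (S n - 1)%nat with n by lia; rewrite H2; unfold alt_strict_sum.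
  replace (S n - 1)%nat with n by lia; rewrite H1.
  (* The unbarred merged entry arises as a product of two signs; restoring them lets [field] match
     the two sides. *)
  replace (1 / odd_real (S n) ^ (2*a+2*b+4))
    with ((-1) ^ S n * (-1) ^ S n / odd_real (S n) ^ (2*a+2*b+4))
    by now rewrite sqr_pow_m1.
  (* The inner sums are made opaque so that [cbn] only reduces the empty [t_part] to [1]. *)
  generalize (t_part [br (2*c+1)] n) (t_part [br (2*b+2); br (2*c+1)] n)
    (t_part [nb (2*b+2*c+3)] n); intros x y z; cbn [t_part]; field_odd.
Qed.

Lemma series_33 (a b c n : nat) :
  sumk (fun k => (-1) ^ k / odd_real k * (/ odd_real k ^ (2 * a) *
    (/ odd_real k * strict_sum (fun j => / odd_real j ^ 2 *
      (/ odd_real j ^ (2 * b) *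
        (/ odd_real j * strict_sum (fun i =>
           / odd_real i ^ 2 * (/ odd_real i ^ (2 * c) * 1)) j))) k))) n
  = t_part [br (2*a+2*b+2*c+7)] n
    + 2 * t_part [br (2*a+2); nb (2*b+2*c+5)] n
    + 2 * t_part [br (2*a+2*b+5); nb (2*c+2)] n
    + 4 * t_part [br (2*a+2); nb (2*b+3); nb (2*c+2)] n.
Proof.
  assert (H1 : forall m,
    sumk (fun i => / odd_real i ^ 2 * (/ odd_real i ^ (2 * c) * 1)) m
    = t_part [nb (2*c+2)] m).
  { induction m as [|m IH]; [reflexivity|].
    rewrite sumk_S, t_part_nb_S, IH; cbn [t_part]; field_odd. }
  assert (H2 : forall m,
    sumk (fun j => / odd_real j ^ 2 * (/ odd_real j ^ (2 * b) *
      (/ odd_real j * strict_sum (fun i =>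
         / odd_real i ^ 2 * (/ odd_real i ^ (2 * c) * 1)) j))) m
    = t_part [nb (2*b+2*c+5)] m + 2 * t_part [nb (2*b+3); nb (2*c+2)] m).
  { induction m as [|m IH]; [simpl; ring|].
    rewrite sumk_S, !t_part_nb_S, IH; unfold strict_sum.
    replace (S m - 1)%nat with m by lia; rewrite H1.
    generalize (t_part [nb (2*c+2)] m); intros x; cbn [t_part]; field_odd. }
  induction n as [|n IH]; [simpl; ring|].
  rewrite sumk_S, !t_part_br_S, IH; unfold strict_sum at 1.
  replace (S n - 1)%nat with n by lia; rewrite H2; unfold strict_sum.
  replace (S n - 1)%nat with n by lia; rewrite H1.
  generalize (t_part [nb (2*c+2)] n) (t_part [nb (2*b+3); nb (2*c+2)] n)
    (t_part [nb (2*b+2*c+5)] n); intros x y z; cbn [t_part]; field_odd.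
Qed.

(** * Passage to the limit *)

Ltac t_part_converges :=
  apply t_part_lim; [lia|];
  repeat first
    [apply t_part_nil_bounded | apply t_part_alt_bounded
    | apply t_part_bounded; [lia|]].

Theorem theorem4p5 (a b c : nat) :
  tstar (repeat 2%nat a ++ 3%nat :: repeat 2%nat b ++ 1%nat :: repeat 2%nat c)
  = - (4 / PI) * tval [br (2*a+2*b+2*c+5)]
    - (8 / PI) * tval [br (2*a+2); nb (2*b+2*c+3)]
    - (8 / PI) * tval [nb (2*a+2*b+4); br (2*c+1)]
    - (16 / PI) * tval [br (2*a+2); br (2*b+2); br (2*c+1)]
  /\
  tstar (repeat 2%nat a ++ 3%nat :: repeat 2%nat b ++ 3%nat :: repeat 2%nat c)
  = - (4 / PI) * tval [br (2*a+2*b+2*c+7)]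
    - (8 / PI) * tval [br (2*a+2); nb (2*b+2*c+5)]
    - (8 / PI) * tval [br (2*a+2*b+5); nb (2*c+2)]
    - (16 / PI) * tval [br (2*a+2); nb (2*b+3); nb (2*c+2)].
Proof.
  split.
  - erewrite tstar_transform; [|apply tstar_part_31|].
    2: { eapply is_lim_seq_ext; [intros n; symmetry; apply series_31|].
         repeat apply is_lim_seq_plus';
           [|apply is_lim_seq_mult'; [apply is_lim_seq_const|] ..]; t_part_converges. }
    unfold br, nb; field; apply PI_neq0.
  - erewrite tstar_transform; [|apply tstar_part_33|].
    2: { eapply is_lim_seq_ext; [intros n; symmetry; apply series_33|].
         repeat apply is_lim_seq_plus';
           [|apply is_lim_seq_mult'; [apply is_lim_seq_const|] ..]; t_part_converges. }
    unfold br, nb; field; apply PI_neq0.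
Qed.
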